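(* Let $A$ be a finite dimensional standardly stratified algebra over a field $K$, with simple modules indexed by $\Lambda^+$, standard modules $\Delta(\lambda)$ and proper costandard modules $\overline{\nabla}(\lambda)$ ($\lambda\in\Lambda^+$). Let $T$ be a tilting $A$-module. Suppose that there is an integer $r\in\mathbb{N}$ such that for every $\lambda\in\Lambda^+$ there are an injective $A$-module homomorphism $\iota_\lambda:\Delta(\lambda)\hookrightarrow T^{\oplus r}$ and a surjective $A$-module homomorphism $\pi_\lambda:T^{\oplus r}\twoheadrightarrow\overline{\nabla}(\lambda)$. Then $T$ is a faithful $A$-module and $A$ has the double centraliser property with respect to $T$; that is, the canonical map gives $A=\operatorname{End}_{\operatorname{End}_A(T)}(T)$.
   Context: Let $K$ be a field and $A$ a finite dimensional unital $K$-algebra; modules are finite dimensional left modules (category $A$-mod). $\{L(\lambda)\mid\lambda\in\Lambda^+\}$ is a complete set of representatives of isomorphism classes of simple $A$-modules, and $A$ is assumed split over $K$, i.e. $\operatorname{End}_A(L(\lambda))=K$ for all $\lambda$. $P(\lambda)$ and $I(\lambda)$ denote the projective cover and injective hull of $L(\lambda)$. The trace $\operatorname{Tr}_M(N)$ is the sum of the images of all $A$-homomorphisms $M\to N$. $[M:L]$ denotes composition multiplicity. Standardly stratified algebra (in the sense of Cline-Parshall-Scott): there is a partial preorder $\preceq$ on $\Lambda^+$ such that, setting $P^{\succ\lambda}:=\bigoplus_{\mu\succ\lambda}P(\mu)$ and $\Delta(\lambda):=P(\lambda)/\operatorname{Tr}_{P^{\succ\lambda}}(P(\lambda))$ (the standard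 module), for each $\lambda$: (1) the kernel of the canonical surjection $P(\lambda)\twoheadrightarrow\Delta(\lambda)$ has a filtration with subquotients $\Delta(\mu)$, $\mu\succ\lambda$; (2) the kernel of the canonical surjection $\Delta(\lambda)\twoheadrightarrow L(\lambda)$ has a filtration with subquotients $L(\mu)$, $\mu\preceq\lambda$. (Here $\mu\succ\lambda$ means $\mu\succeq\lambda$ and not $\mu\preceq\lambda$.) The proper costandard module $\overline{\nabla}(\lambda)$ is the preimage, under $I(\lambda)\twoheadrightarrow I(\lambda)/\operatorname{soc}I(\lambda)$, of the intersection of the kernels of all homomorphisms $I(\lambda)/\operatorname{soc}I(\lambda)\to\bigoplus_{\mu\succeq\lambda}I(\mu)$; equivalently, it is the largest submodule of $I(\lambda)$ containing the socle with $[\overline{\nabla}(\lambda)/\operatorname{soc}\overline{\nabla}(\lambda):L(\mu)]=0$ for all $\mu\succeq\lambda$. $\mathcal{F}(\Delta)$ (resp. $\mathcal{F}(\overline{\nabla})$) is the full subcategory of $A$-mod of modules having a filtration all of whose subquotients are of the form $\Delta(\lambda)$ (resp. $\overline{\nabla}(\lambda)$). A tilting module is an object of $\mathcal{F}(\Delta)\cap\mathcal{F}(\overline{\nabla})$. Double centraliser property: $T$ is naturally a left module over $A'=\operatorname{End}_A(T)$, and there is a canonical algebra homomorphism $A\to\operatorname{End}_{A'}(T)$; $A$ has the double centraliser property with respect to $T$ if this homomorphism is surjective. *)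

(* Defs.v *)
From HB Require Import structures.
From mathcomp Require Import all_boot all_order all_algebra all_field.
From mathcomp Require Import boolp.

Set Implicit Arguments.
Unset Strict Implicit.
Unset Printing Implicit Defensive.

Import Order.TTheory GRing.Theory.
Local Open Scope ring_scope.

(* An A-module is a record over its underlying K-space, rather than an
   [lmodType A], because its carrier already has a scaling by K. *)
Record amodule (K : fieldType) (A : falgType K) := AModule {
  acar :> vectType K;
  act : A -> acar -> acar;
  actDr : forall k a x y, act a (k *: x + y) = k *: act a x + act a y;
  actDl : forall k a b x, act (k *: a + b) x = k *: act a x + act b x;
  act1 : forall x, act 1 x = x;
  actM : forall a b x, act (a * b) x = act a (act b x) }.

Record modhom (K : fieldType) (A : falgType K) (M N : amodule A) := ModHom {
  hlin :> 'Hom(M, N);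
  hact : forall a (x : M), hlin (act a x) = act a (hlin x) }.

Record submodule (K : fieldType) (A : falgType K) (M : amodule A) := SubModule {
  sspace :> {vspace M};
  sact : forall a (x : M), x \in sspace -> act a x \in sspace }.

Section Modules.
Variables (K : fieldType) (A : falgType K).
Implicit Types M N : amodule A.

Definition hsurj M N (f : modhom M N) := forall y : N, exists x : M, f x = y.

Definition mod_iso M N := exists f : modhom M N, bijective f.

Lemma act0r M a : act a (0 : M) = 0.
Proof. by move: (actDr (a0 := M) (-1) a 0 0); rewrite scaler0 addr0 scaleN1r addNr. Qed.

Lemma himg_act M N (f : modhom M N) a (y : N) : y \in limg f -> act a y \in limg f.
Proof. by case/memv_imgP=> x _ ->; rewrite -hact memv_img ?memvf. Qed.
Definition himg M N (f : modhom M N) := SubModule (himg_act (f := f)).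

Lemma hker_act M N (f : modhom M N) a (x : M) : x \in lker f -> act a x \in lker f.
Proof. by rewrite !memv_ker hact => /eqP->; rewrite act0r. Qed.
Definition hker M N (f : modhom M N) := SubModule (hker_act (f := f)).

Lemma hpreim_act M N (f : modhom M N) (U : submodule N) a (x : M) :
  x \in (f @^-1: U)%VS -> act a x \in (f @^-1: U)%VS.
Proof. by rewrite -!memv_preim hact; exact: sact. Qed.
Definition hpreim M N (f : modhom M N) (U : submodule N) :=
  SubModule (hpreim_act (f := f) (U := U)).

Section Sub.
Variables (M : amodule A) (U : submodule M).

Definition sub_act (a : A) (x : subvs_of U) : subvs_of U :=
  vsproj U (act a (vsval x)).

Lemma vsval_sub_act a x : vsval (sub_act a x) = act a (vsval x).
Proof. by rewrite vsprojK // sact // subvsP. Qed.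

Lemma sub_actDr k a x y :
  sub_act a (k *: x + y) = k *: sub_act a x + sub_act a y.
Proof. by rewrite /sub_act linearP actDr linearP. Qed.

Lemma sub_actDl k a b x :
  sub_act (k *: a + b) x = k *: sub_act a x + sub_act b x.
Proof. by rewrite /sub_act actDl linearP. Qed.

Lemma sub_act1 x : sub_act 1 x = x.
Proof. by rewrite /sub_act act1 vsvalK. Qed.

Lemma sub_actM a b x : sub_act (a * b) x = sub_act a (sub_act b x).
Proof. by rewrite {1}/sub_act actM -vsval_sub_act. Qed.

Definition submod : amodule A := AModule sub_actDr sub_actDl sub_act1 sub_actM.

Lemma sincl_act a (x : submod) :
  linfun (vsval : submod -> M) (act a x) = act a (linfun (vsval : submod -> M) x).
Proof. by rewrite !lfunE /= vsval_sub_act. Qed.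
Definition sincl : modhom submod M := ModHom sincl_act.

(* The quotient M/U is carried by the complement U^C. *)
Definition quo_proj (x : M) : subvs_of U^C := vsproj U^C (x - projv U x).

Lemma quo_proj_linear : linear quo_proj.
Proof.
move=> k x y; rewrite /quo_proj -linearP; congr (vsproj _ _).
by rewrite linearP scalerBr opprD addrACA.
Qed.
HB.instance Definition _ :=
  GRing.isLinear.Build K M (subvs_of U^C) *:%R quo_proj quo_proj_linear.

Lemma vsval_quo_proj x : vsval (quo_proj x) = x - projv U x.
Proof. by rewrite vsprojK // memv_projC. Qed.

Lemma quo_proj_eq0 x : (quo_proj x == 0) = (x \in U).
Proof.
rewrite -(inj_eq val_inj) /= vsval_quo_proj subr_eq0.
by apply/eqP/idP=> [-> | /projv_id//]; exact: memv_proj.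
Qed.

Lemma quo_proj_eq x y : (x - y \in U) -> quo_proj x = quo_proj y.
Proof. by rewrite -quo_proj_eq0 linearB subr_eq0 => /eqP. Qed.

Lemma quo_projK y : quo_proj (vsval y) = y.
Proof.
apply: val_inj; rewrite /= vsval_quo_proj.
suff /eqP->: projv U (vsval y) == 0 by rewrite subr0.
by rewrite -memv_ker lker_proj subvsP.
Qed.

Definition quo_act (a : A) (x : subvs_of U^C) := quo_proj (act a (vsval x)).

Lemma quo_proj_act a x : quo_proj (act a x) = quo_act a (quo_proj x).
Proof.
apply: quo_proj_eq; rewrite vsval_quo_proj.
have -> : x - projv U x = (-1) *: projv U x + x by rewrite scaleN1r addrC.
by rewrite actDr scaleN1r opprD opprK addrCA subrr addr0 sact // memv_proj.
Qed.

Lemma quo_actDr k a x y :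
  quo_act a (k *: x + y) = k *: quo_act a x + quo_act a y.
Proof. by rewrite /quo_act linearP actDr linearP. Qed.

Lemma quo_actDl k a b x :
  quo_act (k *: a + b) x = k *: quo_act a x + quo_act b x.
Proof. by rewrite /quo_act actDl linearP. Qed.

Lemma quo_act1 x : quo_act 1 x = x.
Proof. by rewrite /quo_act act1 quo_projK. Qed.

Lemma quo_actM a b x : quo_act (a * b) x = quo_act a (quo_act b x).
Proof. by rewrite {1}/quo_act actM quo_proj_act. Qed.

Definition quomod : amodule A := AModule quo_actDr quo_actDl quo_act1 quo_actM.

Lemma qproj_act a (x : M) :
  linfun (quo_proj : M -> quomod) (act a x)
    = act a (linfun (quo_proj : M -> quomod) x).
Proof. by rewrite !lfunE /= quo_proj_act. Qed.
Definition qproj : modhom M quomod := ModHom qproj_act.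

Lemma lker_qproj : lker qproj = U.
Proof. by apply/vspaceP=> x; rewrite memv_ker lfunE /= quo_proj_eq0. Qed.

Lemma qproj_surj : hsurj qproj.
Proof. by move=> y; exists (vsval y); rewrite lfunE /= quo_projK. Qed.

End Sub.

(* The subquotient V/U, for U contained in V. *)
Definition subquo M (U V : submodule M) := quomod (hpreim (sincl V) U).

Section Sum.
Variables M N : amodule A.

Definition pair_act (a : A) (x : M * N) : M * N := (act a x.1, act a x.2).

Lemma pair_actDr k a x y :
  pair_act a (k *: x + y) = k *: pair_act a x + pair_act a y.
Proof. by congr pair; exact: actDr. Qed.

Lemma pair_actDl k a b x :
  pair_act (k *: a + b) x = k *: pair_act a x + pair_act b x.
Proof. by congr pair; exact: actDl. Qed.

Lemma pair_act1 x : pair_act 1 x = x.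
Proof. by case: x => x y; rewrite /pair_act !act1. Qed.

Lemma pair_actM a b x : pair_act (a * b) x = pair_act a (pair_act b x).
Proof. by rewrite /pair_act !actM. Qed.

Definition sum2 : amodule A :=
  AModule pair_actDr pair_actDl pair_act1 pair_actM.

End Sum.

Definition zeromod : amodule A.
Proof.
by exists 'rV[K]_0 (fun _ _ => 0) => *; rewrite ?scaler0 ?addr0 // [RHS]thinmx0.
Defined.

Definition dsum (s : seq (amodule A)) : amodule A := foldr sum2 zeromod s.

Lemma subspace_inf_ex (V : vectType K) (S : {vspace V} -> Prop) :
  exists W : {vspace V}, forall x, x \in W <-> forall U, S U -> x \in U.
Proof.
suff H n (W0 : {vspace V}) : (\dim W0 <= n)%N ->
    exists W : {vspace V}, forall x, x \in W <-> x \in W0 /\ forall U, S U -> x \in U.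
  have [W WP] := H _ fullv (leqnn _); exists W => x; rewrite WP.
  by split=> [[]|] //; rewrite memvf.
elim: n W0 => [|n IHn] W0 leW.
  exists W0 => x; split=> [xW|[]//]; split=> // U _.
  move: leW xW; rewrite leqn0 dimv_eq0 => /eqP-> /[!memv0] /eqP->.
  exact: mem0v.
case: (pselect (exists2 U, S U & ~~ (W0 <= U)%VS)) => [[U SU nWU]|nU].
  have [|W WP] := IHn (W0 :&: U)%VS.
    rewrite -ltnS (leq_trans _ leW) // ltn_neqAle dimvS ?capvSl // andbT.
    apply: contra nWU => eqd.
    have: (W0 :&: U == W0)%VS by rewrite eqEdim capvSl (eqP eqd) /=.
    by move=> /eqP <-; exact: capvSr.
  exists W => x; rewrite WP memv_cap; split=> [[/andP[xW _] xS]|[xW xS]] //.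
  by split=> //; rewrite xW xS.
exists W0 => x; split=> [xW|[]//]; split=> // U SU.
apply: (subvP _ _ xW); apply: contrapT => /negP nWU.
by apply: nU; exists U.
Qed.

Definition subspace_inf (V : vectType K) (S : {vspace V} -> Prop) : {vspace V} :=
  sval (cid (subspace_inf_ex S)).

Lemma sub_inf_act M (S : submodule M -> Prop) a (x : M) :
  x \in subspace_inf (fun W => exists2 U : submodule M, S U & W = U) ->
  act a x \in subspace_inf (fun W => exists2 U : submodule M, S U & W = U).
Proof.
rewrite /subspace_inf; case: cid => W /= WP /WP xS; apply/WP.
by move=> _ [U SU ->]; apply: sact; apply: xS; exists U.
Qed.

(* The intersection of an arbitrary family of submodules. *)
Definition sub_inf M (S : submodule M -> Prop) : submodule M :=
  SubModule (sub_inf_act (S := S)).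

Lemma sub_infP M (S : submodule M -> Prop) (x : M) :
  x \in sub_inf S <-> forall U : submodule M, S U -> x \in U.
Proof.
rewrite /= /subspace_inf; case: cid => W /= ->; split=> xS.
  by move=> U SU; apply: xS; exists U.
by move=> _ [U SU ->]; exact: xS.
Qed.

(* The sum of an arbitrary family of submodules: the smallest submodule
   containing them all. *)
Definition sub_sum M (S : submodule M -> Prop) : submodule M :=
  sub_inf (fun W => forall U : submodule M, S U -> (U <= W)%VS).

Lemma sub_sum_sup M (S : submodule M -> Prop) (U : submodule M) :
  S U -> (U <= sub_sum S)%VS.
Proof. by move=> SU; apply/subvP=> x xU; apply/sub_infP=> W /(_ U SU)/subvP; apply. Qed.

Lemma sub_sum_min M (S : submodule M -> Prop) (W : submodule M) :
  (forall U, S U -> (U <= W)%VS) -> (sub_sum S <= W)%VS.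
Proof. by move=> SW; apply/subvP=> x /sub_infP; apply. Qed.

Definition mod_trace M N : submodule N :=
  sub_sum (fun U => exists f : modhom M N, U = himg f).

Definition simple_module M :=
  (fullv : {vspace M}) <> 0%VS
  /\ forall U : submodule M, U = 0%VS :> {vspace M} \/ U = fullv :> {vspace M}.

Definition socle M : submodule M := sub_sum (fun U => simple_module (submod U)).

Definition projective_module M :=
  forall (N N' : amodule A) (g : modhom N N') (f : modhom M N'),
    hsurj g -> exists h : modhom M N, forall x, g (h x) = f x.

Definition injective_module M :=
  forall (N N' : amodule A) (g : modhom N' N) (f : modhom N' M),
    injective g -> exists h : modhom N M, forall x, h (g x) = f x.

Definition projective_cover M N (p : modhom M N) :=
  [/\ projective_module M, hsurj p
    & forall U : submodule M, (U + lker p)%VS = fullv -> U = fullv :> {vspace M}].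

Definition injective_hull M N (j : modhom M N) :=
  [/\ injective_module N, injective j
    & forall U : submodule N, (U :&: limg j)%VS = 0%VS -> U = 0%VS :> {vspace N}].

(* M has a finite filtration whose subquotients are all isomorphic to members
   D mu of the family with Q mu. *)
Definition filtered (Lam : Type) (D : Lam -> amodule A) (Q : Lam -> bool) M :=
  exists (n : nat) (c : nat -> submodule M),
    [/\ c 0%N = 0%VS :> {vspace M}, c n = fullv :> {vspace M}
      & forall i, (i < n)%N ->
          (c i <= c i.+1)%VS
          /\ exists2 mu, Q mu & mod_iso (subquo (c i) (c i.+1)) (D mu)].

Definition simple_representatives (Lam : finType) (L : Lam -> amodule A) :=
  [/\ forall lam, simple_module (L lam),
      forall lam mu, mod_iso (L lam) (L mu) -> lam = mu
    & forall M, simple_module M -> exists lam, mod_iso M (L lam)].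

Definition split_over (Lam : finType) (L : Lam -> amodule A) :=
  forall lam (f : modhom (L lam) (L lam)),
    exists c : K, forall x, f x = c *: x.

Section Stratified.
Variables (disp : Order.disp_t) (Lam : finPreorderType disp).
Variables (L P I : Lam -> amodule A).

(* In a preorder, [lam < mu] is [lam <= mu] and not [mu <= lam]. *)
Definition Pabove (lam : Lam) : amodule A :=
  dsum [seq P mu | mu <- enum Lam & (lam < mu)%O].

Definition standard (lam : Lam) : amodule A :=
  quomod (mod_trace (Pabove lam) (P lam)).

Definition standard_proj (lam : Lam) : modhom (P lam) (standard lam) :=
  qproj (mod_trace (Pabove lam) (P lam)).

(* In (2) the canonical surjection is the map g through which p factors. *)
Definition standardly_stratified (p : forall lam, modhom (P lam) (L lam)) :=
  forall lam,
    filtered standard (fun mu => (lam < mu)%O) (submod (hker (standard_proj lam)))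
    /\ exists2 g : modhom (standard lam) (L lam),
         (forall x, g (standard_proj lam x) = p lam x)
         & filtered L (fun mu => (mu <= lam)%O) (submod (hker g)).

Definition proper_costandard_sub (lam : Lam) : submodule (I lam) :=
  let S := socle (I lam) in
  let E := dsum [seq I mu | mu <- enum Lam & (lam <= mu)%O] in
  hpreim (qproj S)
    (sub_inf (fun U => exists f : modhom (quomod S) E, U = hker f)).

Definition proper_costandard (lam : Lam) : amodule A :=
  submod (proper_costandard_sub lam).

Definition tilting (T : amodule A) :=
  filtered standard predT T /\ filtered proper_costandard predT T.

End Stratified.

Definition faithful_module M := forall a : A, (forall x : M, act a x = 0) -> a = 0.

(* A K-linear g is A'-linear, for A' = End_A(M), when it commutes with every
   f in A'; and A -> End_A'(M) sends a to the action of a. *)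
Definition double_centraliser M :=
  forall g : 'End(M), (forall (f : modhom M M) x, g (f x) = f (g x)) ->
    exists a : A, forall x, act a x = g x.

End Modules.

(* Main.v *)
Require Import Defs.
From HB Require Import structures.
From mathcomp Require Import all_boot all_order all_algebra all_field.
From mathcomp Require Import boolp.

Set Implicit Arguments.
Unset Strict Implicit.
Unset Printing Implicit Defensive.

Import Order.TTheory GRing.Theory.
Local Open Scope ring_scope.

(* Write C' for the image of A in T^n under a left add(T)-approximation, and C for
   the cokernel.  An element of End_{End_A(T)}(T) acts on T^n, commutes with every
   T^n -> T, and so sends the image of 1 into C' as soon as C is cogenerated by T.
   Every map A -> nabla(lam) lifts through T^r, hence extends to T^n; as
   Ext^1(T, nabla(lam)) = 0 this gives Ext^1(C, nabla(lam)) = 0 for all lam.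
   A module orthogonal in this way to all nabla(lam) is built from standard
   modules: one splits off from the bottom a copy of Delta(tau), with tau maximal
   among the tops of maps P(tau) -> C, and inducts on the dimension.  Finally each
   Delta(tau) embeds in T^r and Ext^1(Delta(tau), T) = 0, so such modules are
   cogenerated by T.  Applied to A itself, this is faithfulness. *)

(** * Homomorphisms, factorisations and short exact sequences *)

Section ModuleHoms.
Variables (K : fieldType) (A : falgType K).
Implicit Types M N E I Q X Y : amodule A.

Lemma hom_exists M N (f : M -> N) :
  (forall k x y, f (k *: x + y) = k *: f x + f y) ->
  (forall a x, f (act a x) = act a (f x)) ->
  exists h : modhom M N, forall x, h x = f x.
Proof.
move=> flin fact.
pose fl : {linear M -> N} := HB.pack f (GRing.isLinear.Build K M N *:%R f flin).
have lE x : linfun fl x = f x by rewrite lfunE.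
have la a (x : M) : linfun fl (act a x) = act a (linfun fl x).
  by rewrite !lE fact.
by exists (ModHom la).
Qed.

Lemma hcomp_act M N X (g : modhom N X) (f : modhom M N) a (x : M) :
  (g \o f)%VF (act a x) = act a ((g \o f)%VF x).
Proof. by rewrite !comp_lfunE !hact. Qed.
Definition hcomp M N X (g : modhom N X) (f : modhom M N) : modhom M X :=
  ModHom (hcomp_act g f).

Lemma hcompE M N X (g : modhom N X) (f : modhom M N) x : hcomp g f x = g (f x).
Proof. exact: comp_lfunE. Qed.

Lemma hid_act M a (x : M) : (\1%VF : 'Hom(M, M)) (act a x) = act a ((\1%VF : 'Hom(M, M)) x).
Proof. by rewrite !id_lfunE. Qed.
Definition hid M : modhom M M := ModHom (@hid_act M).

Lemma hidE M (x : M) : hid M x = x. Proof. exact: id_lfunE. Qed.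

Lemma actD M a (x y : M) : act a (x + y) = act a x + act a y.
Proof. by have := actDr (a0 := M) 1 a x y; rewrite !scale1r. Qed.

Lemma actZ M a k (x : M) : act a (k *: x) = k *: act a x.
Proof. by have := actDr (a0 := M) k a x 0; rewrite act0r !addr0. Qed.

Lemma act_sum M a (J : Type) (s : seq J) (F : J -> M) :
  act a (\sum_(i <- s) F i) = \sum_(i <- s) act a (F i).
Proof.
by elim: s => [|i s IHs]; rewrite ?big_nil ?act0r // !big_cons actD IHs.
Qed.

Lemma haxpy_act M N k (f g : modhom M N) a (x : M) :
  (k *: (f : 'Hom(M, N)) + g) (act a x) = act a ((k *: (f : 'Hom(M, N)) + g) x).
Proof. by rewrite !(add_lfunE, scale_lfunE) !hact actD actZ. Qed.
(** One operation for sums and differences: [k = -1] gives [g - f]. *)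
Definition haxpy M N k (f g : modhom M N) : modhom M N := ModHom (haxpy_act k f g).

Lemma haxpyE M N k (f g : modhom M N) x : haxpy k f g x = k *: f x + g x.
Proof. by rewrite /haxpy /= add_lfunE scale_lfunE. Qed.

Lemma hzero_act M N a (x : M) : (0 : 'Hom(M, N)) (act a x) = act a ((0 : 'Hom(M, N)) x).
Proof. by rewrite !zero_lfunE act0r. Qed.
Definition hzero M N : modhom M N := ModHom (@hzero_act M N).

Lemma hzeroE M N (x : M) : hzero M N x = 0.
Proof. exact: zero_lfunE. Qed.

Lemma hom_injP M N (f : modhom M N) :
  injective f <-> forall x, f x = 0 -> x = 0.
Proof.
split=> [inj x fx0|f0 x y /eqP]; first by apply: inj; rewrite fx0 linear0.
by rewrite -subr_eq0 -linearB => /eqP/f0/eqP; rewrite subr_eq0 => /eqP.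
Qed.

Lemma homZ M N (f : modhom M N) k x : f (k *: x) = k *: f x.
Proof. exact: linearZ. Qed.

Lemma mem_himg M N (f : modhom M N) y : (y \in himg f) <-> exists x, y = f x.
Proof.
split=> [/memv_imgP[x _ ->]|[x ->]]; first by exists x.
by rewrite /= memv_img ?memvf.
Qed.

Lemma mem_hker M N (f : modhom M N) x : (x \in hker f) = (f x == 0).
Proof. by rewrite /= memv_ker. Qed.

Lemma sinclE M (U : submodule M) x : sincl U x = vsval x.
Proof. by rewrite /= lfunE. Qed.

Lemma sincl_inj M (U : submodule M) : injective (sincl U).
Proof. by move=> x y; rewrite !sinclE; exact: val_inj. Qed.

Lemma mem_sincl M (U : submodule M) x : x \in U <-> exists y, x = sincl U y.
Proof.
split=> [xU|[y ->]]; last by rewrite sinclE subvsP.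
by exists (vsproj U x); rewrite sinclE vsprojK.
Qed.

Lemma qproj_eq0 M (U : submodule M) x : qproj U x = 0 <-> x \in U.
Proof. by rewrite -[sspace U]lker_qproj memv_ker; split=> /eqP. Qed.

Lemma hom_lift_inj M N X (i : modhom N X) (f : modhom M X) :
  injective i -> (forall x, exists y, f x = i y) ->
  exists h : modhom M N, forall x, i (h x) = f x.
Proof.
move=> inj fP; pose h x := sval (cid (fP x)).
have hE x : i (h x) = f x by rewrite /h; case: cid.
have [|a x|h' h'E] := @hom_exists M N h.
- by move=> k x y; apply: inj; rewrite !linearP /= !hE linearP.
- by apply: inj; rewrite hact !hE hact.
by exists h' => x; rewrite h'E hE.
Qed.

Lemma hom_factor_surj M N X (q : modhom M N) (f : modhom M X) :
  hsurj q -> (forall x, q x = 0 -> f x = 0) ->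
  exists h : modhom N X, forall x, h (q x) = f x.
Proof.
move=> sq kq; pose h y := f (sval (cid (sq y))).
have hE x : h (q x) = f x.
  rewrite /h; case: cid => z /= qz; apply/eqP; rewrite -subr_eq0 -linearB.
  by apply/eqP/kq; rewrite linearB /= qz subrr.
have [|a y|h' h'E] := @hom_exists N X h.
- move=> k x y; have [u <-] := sq x; have [v <-] := sq y.
  by rewrite -linearP !hE linearP.
- by have [u <-] := sq y; rewrite -hact !hE hact.
by exists h' => x; rewrite h'E hE.
Qed.

Definition ses M N X (i : modhom M N) (q : modhom N X) :=
  [/\ injective i, hsurj q & forall x, q x = 0 <-> exists y, x = i y].

Lemma ses_sub M (U : submodule M) : ses (sincl U) (qproj U).
Proof.
split; [exact: sincl_inj|exact: qproj_surj|move=> x].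
by rewrite qproj_eq0 mem_sincl.
Qed.

Lemma ses_ker M N (q : modhom M N) : hsurj q -> ses (sincl (hker q)) q.
Proof.
move=> sq; split=> [||x]; [exact: sincl_inj|by []|].
by rewrite -mem_sincl mem_hker; split=> /eqP.
Qed.

Lemma ses_im M N (f : modhom M N) : injective f -> ses f (qproj (himg f)).
Proof.
move=> injf; split=> [||x]; [by []|exact: qproj_surj|].
by rewrite qproj_eq0 mem_himg.
Qed.

Lemma ses_comp0 M N X (i : modhom M N) (q : modhom N X) x : ses i q -> q (i x) = 0.
Proof. by case=> _ _ ex; apply/ex; exists x. Qed.

Lemma hom_onto_image M N (f : modhom M N) :
  exists2 f' : modhom M (submod (himg f)), hsurj f' & forall x, sincl (himg f) (f' x) = f x.
Proof.
have [x|f' f'E] := hom_lift_inj (f := f) (@sincl_inj _ (himg f)).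
  by apply/mem_sincl/mem_himg; exists x.
exists f' => // y; have /mem_himg[x yE] : sincl (himg f) y \in himg f by apply/mem_sincl; exists y.
by exists x; apply: (@sincl_inj _ (himg f)); rewrite f'E.
Qed.

(** * Extensions *)

(* The vanishing of Ext^1(M, N). *)
Definition ext_vanishes M N :=
  forall E' E (i : modhom E' E) (q : modhom E M), ses i q ->
  forall h : modhom E' N, exists h' : modhom E N, forall x, h' (i x) = h x.

(* For I injective and g onto, this says that Ext^1(M, ker g) = 0. *)
Definition lifts M I Q (g : modhom I Q) :=
  forall h : modhom M Q, exists h' : modhom M I, forall x, g (h' x) = h x.

(** For Y projective and i injective this amounts to Ext^1(coker i, N) = 0. *)
Definition extends X Y (i : modhom X Y) N :=
  forall h : modhom X N, exists h' : modhom Y N, forall x, h' (i x) = h x.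

(* E is the pushout of E' and the projective presentation. *)
Lemma ext_vanishes_proj X Y M N (i0 : modhom X Y) (q0 : modhom Y M) :
  projective_module Y -> ses i0 q0 -> extends i0 N -> ext_vanishes M N.
Proof.
move=> prY ses0 extY E' E i q sesE h; have [inji sq exq] := sesE.
have [_ sq0 exq0] := ses0.
have [u uE] := prY _ _ q q0 sq.
have [x|v vE] := hom_lift_inj (f := hcomp u i0) inji.
  by apply/exq; rewrite hcompE uE; exact: ses_comp0 ses0.
have [w wE] := extY (hcomp h v).
have [k x y|a x|s sE] := @hom_exists (sum2 E' Y) E (fun x => i x.1 + u x.2).
- by rewrite /= !linearP scalerDr addrACA.
- by rewrite /= !hact actD.
have [k x y|a x|t tE] := @hom_exists (sum2 E' Y) N (fun x => h x.1 + w x.2).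
- by rewrite /= !linearP scalerDr addrACA.
- by rewrite /= !hact actD.
(* The map s presents E as a quotient of E' + Y. On its kernel i x.1 = - u x.2, so x.2 = i0 k and
   x.1 = - v k for some k, and there t vanishes. *)
have [y|x|h' h'E] := @hom_factor_surj _ _ _ s t.
- have [p pE] := sq0 (q y).
  have /exq[x xE] : q (y - u p) = 0 by rewrite linearB /= uE pE subrr.
  by exists (x, p); rewrite sE /= -xE subrK.
- rewrite sE tE => /eqP; rewrite addr_eq0 => /eqP ix.
  have : q (i x.1) = 0 by exact: ses_comp0 sesE.
  rewrite ix linearN /= => /eqP; rewrite oppr_eq0 => /eqP.
  rewrite uE => /exq0[k kE].
  have : x.1 = - v k by apply: inji; rewrite ix linearN /= vE hcompE kE.
  by move=> ->; rewrite kE wE hcompE linearN addNr.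
exists h' => x; have := h'E (x, 0); rewrite sE tE /= !linear0 !addr0.
by [].
Qed.

(** The preimage V of M' in E is an extension of M' by E', and E is an extension of M'' by V: extend
    h to V, then to E. *)
Lemma ext_vanishes_ext M' M M'' N (i : modhom M' M) (q : modhom M M'') :
  ses i q -> ext_vanishes M' N -> ext_vanishes M'' N -> ext_vanishes M N.
Proof.
move=> [inji sq exq] ext' ext'' E' E e e' [inje se' exe'] h.
have sqe : hsurj (hcomp q e').
  by move=> y; have [m <-] := sq y; have [x <-] := se' m; exists x; rewrite hcompE.
pose V := hker (hcomp q e').
have VP x : q (e' (sincl V x)) = 0.
  have /mem_sincl : exists y, sincl V x = sincl V y by exists x.
  by rewrite mem_hker hcompE => /eqP.
have [x|c cE] := hom_lift_inj (f := hcomp e' (sincl V)) inji.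
  by apply/exq; rewrite hcompE VP.
have [x|d dE] := hom_lift_inj (f := e) (@sincl_inj _ V).
  apply/mem_sincl; rewrite mem_hker hcompE.
  have -> : e' (e x) = 0 by apply/exe'; exists x.
  by rewrite linear0.
have sesV : ses d c.
  split.
  - by move=> x y dxy; apply: inje; rewrite -!dE dxy.
  - move=> y; have [x xE] := se' (i y).
    have /mem_sincl[v vE] : x \in V.
      rewrite mem_hker hcompE xE; apply/eqP/exq; by exists y.
    by exists v; apply: inji; rewrite cE hcompE -vE.
  move=> v; split=> [cv|[y ->]].
    have /exe'[y yE] : e' (sincl V v) = 0 by rewrite -hcompE -cE cv linear0.
    by exists y; apply: (@sincl_inj _ V); rewrite dE.
  by apply: inji; rewrite cE hcompE dE linear0; apply/exe'; exists y.
have [h1 h1E] := ext' _ _ _ _ sesV h.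
have [h2 h2E] := ext'' _ _ _ _ (ses_ker sqe) h1.
by exists h2 => x; rewrite -dE h2E h1E.
Qed.

(** Extend q h to Y and lift the result along q to f'; the error h - f' i takes values in N', so it
    extends too. *)
Lemma extends_ext X Y N' N N'' (i : modhom X Y) (j : modhom N' N) (q : modhom N N'') :
  projective_module Y -> ses j q -> extends i N' -> extends i N'' -> extends i N.
Proof.
move=> prY [injj sq exq] ext' ext'' h.
have [f fE] := ext'' (hcomp q h).
have [f' f'E] := prY _ _ q f sq.
have [x|k kE] := hom_lift_inj (f := haxpy (-1) (hcomp f' i) h) injj.
  by apply/exq; rewrite haxpyE linearP /= hcompE f'E fE hcompE scaleN1r addNr.
have [k' k'E] := ext' k.
exists (haxpy 1 f' (hcomp j k')) => x.
by rewrite haxpyE hcompE k'E kE haxpyE hcompE scale1r scaleN1r addNKr.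
Qed.

(** Lift h on M' and extend the lift to f' on M by injectivity of I; then h - g f' vanishes on M',
    so it factors through M'' and lifts. *)
Lemma lifts_ext M' M M'' I Q (g : modhom I Q) (i : modhom M' M) (q : modhom M M'') :
  injective_module I -> ses i q -> lifts M' g -> lifts M'' g -> lifts M g.
Proof.
move=> injI [inji sq exq] lift' lift'' h.
have [f fE] := lift' (hcomp h i).
have [f' f'E] := injI _ _ i f inji.
have [x /exq[y ->]|k kE] := @hom_factor_surj _ _ _ q (haxpy (-1) (hcomp g f') h) sq.
  by rewrite haxpyE hcompE f'E fE hcompE scaleN1r addNr.
have [k' k'E] := lift'' k.
exists (haxpy 1 f' (hcomp k' q)) => x.
by rewrite haxpyE linearP /= hcompE k'E kE haxpyE hcompE scale1r scaleN1r addNKr.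
Qed.

(** A lift over N maps N' into X; subtracting an extension to N of this restriction makes the lift
    descend to M. *)
Lemma lifts_quo N' N M X I Q (j : modhom X I) (g : modhom I Q)
    (i : modhom N' N) (q : modhom N M) :
  ses j g -> ses i q -> lifts N g -> extends i X -> lifts M g.
Proof.
move=> sesI sesN liftN extN h; have [injj sg exg] := sesI; have [inji sq exq] := sesN.
have [f fE] := liftN (hcomp h q).
have [x|k kE] := hom_lift_inj (f := hcomp f i) injj.
  by apply/exg; rewrite hcompE fE hcompE (ses_comp0 _ sesN) linear0.
have [k' k'E] := extN k.
have [x /exq[y ->]|t tE] := @hom_factor_surj _ _ _ q (haxpy (-1) (hcomp j k') f) sq.
  by rewrite haxpyE hcompE k'E kE hcompE scaleN1r addNr.
exists t => y; have [x <-] := sq y.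
by rewrite tE haxpyE linearP /= hcompE (ses_comp0 _ sesI) scaler0 add0r fE hcompE.
Qed.

Lemma lifts_proj M I Q (g : modhom I Q) : projective_module M -> hsurj g -> lifts M g.
Proof. by move=> prM sg h; have [f fE] := prM _ _ g h sg; exists f. Qed.

(** Used with Q the cosyzygy of nabla(lam): the first hypothesis then comes from Ext^2(Y/X,
    nabla(lam)) = 0, and the vanishing of Ext^1 passes from Y to X. *)
Lemma lifts_sub X Y I Q (g : modhom I Q) (i : modhom X Y) :
  extends i Q -> lifts Y g -> lifts X g.
Proof.
move=> ext liftY h; have [h1 h1E] := ext h; have [h2 h2E] := liftY h1.
by exists (hcomp h2 i) => x; rewrite hcompE h2E h1E.
Qed.

(** Extend j h to f on E; g f factors through M, hence equals g k' q for some k', and f - k' q takes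
    values in N. *)
Lemma lifts_ext_vanishes M N I Q (j : modhom N I) (g : modhom I Q) :
  injective_module I -> ses j g -> lifts M g -> ext_vanishes M N.
Proof.
move=> injI sesI liftM E' E i q sesE h.
have [injj sg exg] := sesI; have [inji sq exq] := sesE.
have [f fE] := injI _ _ i (hcomp j h) inji.
have [x /exq[y ->]|k kE] := @hom_factor_surj _ _ _ q (hcomp g f) sq.
  by rewrite hcompE fE hcompE (ses_comp0 _ sesI).
have [k' k'E] := liftM k.
have [x|t tE] := hom_lift_inj (f := haxpy (-1) (hcomp k' q) f) injj.
  by apply/exg; rewrite haxpyE linearP /= hcompE k'E kE hcompE scaleN1r addNr.
exists t => x; apply: injj.
by rewrite tE haxpyE hcompE (ses_comp0 _ sesE) linear0 scaler0 add0r fE hcompE.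
Qed.

(** Dimension shift: with Y projective and g onto, Ext^1(X, ker g) = 0 gives Ext^1(Y/X, Q) = 0. *)
Lemma extends_lift X Y I Q (g : modhom I Q) (i : modhom X Y) :
  injective_module I -> injective i -> lifts X g -> extends i Q.
Proof.
move=> injI inji liftX h; have [f fE] := liftX h.
have [f' f'E] := injI _ _ i f inji.
by exists (hcomp g f') => x; rewrite hcompE f'E fE.
Qed.

End ModuleHoms.

(** * Vanishing of Hom and simple modules *)

Section Simples.
Variables (K : fieldType) (A : falgType K).
Implicit Types M N E I Q S T X Y : amodule A.

(** For M = P(sig) this says that L(sig) is not a composition factor of N. *)
Definition hom_zero M N := forall (f : modhom M N) x, f x = 0.

Lemma not_hom_zero M N : ~ hom_zero M N -> exists (f : modhom M N) x, f x <> 0.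
Proof. by move=> /existsNP[f /existsNP[x fx]]; exists f, x. Qed.

Lemma hom_zero_quo X M M'' (q : modhom M M'') :
  projective_module X -> hsurj q -> hom_zero X M -> hom_zero X M''.
Proof.
move=> prX sq hz f x; have [h hE] := prX _ _ q f sq.
by rewrite -hE hz linear0.
Qed.

Lemma hom_zero_ext X M' M M'' (i : modhom M' M) (q : modhom M M'') :
  ses i q -> hom_zero X M' -> hom_zero X M'' -> hom_zero X M.
Proof.
move=> [inj _ ex] hz' hz'' f x.
have [y|h hE] := hom_lift_inj (f := f) inj; first by apply/ex; rewrite -hcompE.
by rewrite -hE hz' linear0.
Qed.

Lemma hom_zero_from_ext X M' M M'' (i : modhom M' M) (q : modhom M M'') :
  ses i q -> hom_zero M' X -> hom_zero M'' X -> hom_zero M X.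
Proof.
move=> [inj sq ex] hz' hz'' f x.
have [y /ex[z ->]|h hE] := @hom_factor_surj _ _ _ _ _ q f sq; first by rewrite -hcompE.
by rewrite -hE hz''.
Qed.

Lemma simple_surj M S (f : modhom M S) x : simple_module S -> f x <> 0 -> hsurj f.
Proof.
move=> [_ /(_ (himg f))[f0|ff]] fx y.
  have /mem_himg : exists x', f x = f x' by exists x.
  by rewrite [sspace _]f0 memv0 => /eqP.
have /mem_himg[z ->] : y \in himg f by rewrite [sspace _]ff memvf.
by exists z.
Qed.

Lemma simple_inj S N (f : modhom S N) x : simple_module S -> f x <> 0 -> injective f.
Proof.
move=> [_ /(_ (hker f))[f0|ff]] fx.
  by apply/hom_injP => y fy; apply/eqP; rewrite -memv0 -f0 mem_hker fy.
by case: fx; apply/eqP; rewrite -mem_hker [sspace _]ff memvf.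
Qed.

Lemma simple_sub_full S (U : submodule S) x :
  simple_module S -> x \in U -> x <> 0 -> forall y, y \in U.
Proof.
move=> [_ /(_ U)[U0|->]] xU x0 y; last exact: memvf.
by move: xU; rewrite [sspace _]U0 memv0 => /eqP.
Qed.

Lemma simple_nonzero S : simple_module S -> exists x : S, x <> 0.
Proof.
move=> [S0 _]; apply: contrapT => nS; apply: S0; apply/vspaceP => x.
rewrite memvf memv0; symmetry; apply/eqP; apply: contrapT => x0.
by apply: nS; exists x.
Qed.

Lemma simple_image S N (f : modhom S N) x :
  simple_module S -> hsurj f -> f x <> 0 -> simple_module N.
Proof.
move=> simS sf fx; split=> [N0|U].
  by apply: fx; apply/eqP; rewrite -memv0 -N0 memvf.
case: simS => _ /(_ (hpreim f U))[U0|Uf]; [left|right]; apply/vspaceP => y.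
- have [z <-] := sf y; rewrite memv0; apply/idP/eqP => [zU|->]; last exact: mem0v.
  have : z \in hpreim f U by rewrite /= -memv_preim.
  by rewrite [sspace _]U0 memv0 => /eqP ->; rewrite linear0.
- have [z <-] := sf y; have : z \in hpreim f U by rewrite [sspace _]Uf memvf.
  by rewrite /= -memv_preim memvf => ->.
Qed.

Lemma dim_quomod_lt M (U : submodule M) x :
  x \in U -> x <> 0 -> (dim (quomod U) < dim M)%N.
Proof.
move=> xU x0; have -> : dim (quomod U) = \dim (sspace U)^C%VS by [].
have U0 : (0 < \dim U)%N.
  by rewrite lt0n dimv_eq0; apply/eqP => U0; move: xU; rewrite U0 memv0 => /eqP.
rewrite dimv_compl dimvf ltn_subrL U0 /= -dimvf.
by apply: leq_trans U0 _; apply: dimvS; exact: subvf.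
Qed.

Lemma exists_simple_quotient M (x : M) :
  x <> 0 -> exists (S : amodule A) (q : modhom M S), simple_module S /\ hsurj q.
Proof.
move: {2}(dim M).+1 (ltnSn (dim M)) => n; elim: n M x => // n IHn M x ltM x0.
have [simM|nsim] := pselect (simple_module M).
  by exists M, (hid M); split=> // y; exists y; rewrite hidE.
have [U [U0 Uf]] : exists U : submodule M, sspace U <> 0%VS /\ sspace U <> fullv.
  apply: contrapT => nU; apply: nsim; split.
    by move=> M0; apply: x0; apply/eqP; rewrite -memv0 -M0 memvf.
  move=> U; have [|U0] := pselect (sspace U = 0%VS); first by left.
  right; apply: contrapT => Uf; apply: nU; by exists U.
have [u uU u0] : exists2 u, u \in U & u <> 0.
  apply: contrapT => nu; apply: U0; apply/vspaceP => u; rewrite memv0.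
  apply/idP/eqP => [uU|->]; last exact: mem0v.
  by apply: contrapT => u0; apply: nu; exists u.
have [y yU] : exists y, y \notin U.
  apply: contrapT => ny; apply: Uf; apply/vspaceP => y; rewrite memvf.
  by apply/negPn/negP => yU; apply: ny; exists y.
have [||S [q [simS sq]]] := IHn (quomod U) (qproj U y).
- by rewrite -ltnS (leq_trans _ ltM) // ltnS (dim_quomod_lt uU u0).
- by move/qproj_eq0; apply/negP.
exists S, (hcomp q (qproj U)); split=> // z; have [w <-] := sq z.
by have [v <-] := qproj_surj w; exists v; rewrite hcompE.
Qed.

Lemma bij_hom M N (f : modhom M N) : injective f -> hsurj f -> bijective f.
Proof.
move=> inj sf; exists (fun y => sval (cid (sf y))) => y; case: cid => //= z.
by move/inj.
Qed.

Lemma bij_surj M N (f : modhom M N) : bijective f -> hsurj f.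
Proof. by case=> g _ gK y; exists (g y). Qed.

(** * Filtrations and direct sums *)

(** The chain is peeled from the top. Each stage is an abstract N injected into M with image [c k],
    so that the kernel of N -> [D mu] is again such a stage. *)
Lemma filtered_ind (Lam : Type) (D : Lam -> amodule A) (R : Lam -> bool)
    (Z : amodule A -> Prop) :
  (forall N, (forall x : N, x = 0) -> Z N) ->
  (forall N mu (q : modhom N (D mu)),
     R mu -> hsurj q -> Z (submod (hker q)) -> Z N) ->
  forall M, filtered D R M -> Z M.
Proof.
move=> Z0 ZS M [n [c [c0 cn cS]]].
suff H k N (i : modhom N M) : (k <= n)%N -> injective i ->
    (forall y, y \in c k <-> exists x, y = i x) -> Z N.
  apply: (H n M (hid M)) => // [x y|y]; first by rewrite !hidE.
  by rewrite cn memvf; split=> // _; exists y; rewrite hidE.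
elim: k N i => [|k IHk] N i len inji imi.
  apply: Z0 => x; apply: inji; rewrite linear0; apply/eqP.
  by rewrite -memv0 -c0; apply/imi; exists x.
have [leU [mu Rmu [u biju]]] := cS k len.
have [x|f fE] := hom_lift_inj (f := i) (@sincl_inj _ _ _ (c k.+1)).
  by apply/mem_sincl/imi; exists x.
pose W := hpreim (sincl (c k.+1)) (c k).
pose q := hcomp u (hcomp (qproj W) f).
have q0 x : q x = 0 <-> i x \in c k.
  rewrite !hcompE -fE; split=> [ux|fx].
    have /qproj_eq0 : qproj W (f x) = 0 by apply: (bij_inj biju); rewrite ux linear0.
    by rewrite /= -memv_preim.
  suff -> : qproj W (f x) = 0 by rewrite linear0.
  by apply/qproj_eq0; rewrite /= -memv_preim.
apply: (ZS N mu q) => // [y|].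
  have [z <-] := bij_surj biju y; have [w <-] := qproj_surj z.
  have /imi[x xE] : sincl (c k.+1) w \in c k.+1 by apply/mem_sincl; exists w.
  exists x; rewrite !hcompE; congr (u (qproj W _)).
  by apply: (@sincl_inj _ _ _ (c k.+1)); rewrite fE.
apply: (IHk _ (hcomp i (sincl (hker q)))) => [|x y|y]; first exact: ltnW.
  by rewrite !hcompE => /inji/sincl_inj.
split=> [yk|[x ->]].
  have /imi[x xE] := subvP leU _ yk.
  have /mem_sincl[z zE] : x \in hker q by rewrite mem_hker; apply/eqP/q0; rewrite -xE.
  by exists z; rewrite hcompE -zE.
rewrite hcompE; apply/q0/eqP; rewrite -mem_hker; apply/mem_sincl; by exists x.
Qed.

Lemma sum2_homs M N :
  exists (i1 : modhom M (sum2 M N)) (i2 : modhom N (sum2 M N))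
         (p1 : modhom (sum2 M N) M) (p2 : modhom (sum2 M N) N),
  [/\ forall x, i1 x = (x, 0), forall y, i2 y = (0, y),
      forall z, p1 z = z.1 & forall z, p2 z = z.2].
Proof.
have [k x y|a x|i1 i1E] := @hom_exists _ _ M (sum2 M N) (fun x => (x, 0)).
- by congr pair; rewrite /= scaler0 addr0.
- by congr pair; rewrite /= act0r.
have [k x y|a x|i2 i2E] := @hom_exists _ _ N (sum2 M N) (fun x => (0, x)).
- by congr pair; rewrite /= scaler0 addr0.
- by congr pair; rewrite /= act0r.
have [//|//|p1 p1E] := @hom_exists _ _ (sum2 M N) M (fun x => x.1).
have [//|//|p2 p2E] := @hom_exists _ _ (sum2 M N) N (fun x => x.2).
by exists i1, i2, p1, p2.
Qed.

Lemma hom_zero_dsum (J : eqType) (F : J -> amodule A) (s : seq J) M :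
  (forall i, i \in s -> hom_zero M (F i)) -> hom_zero M (dsum (map F s)).
Proof.
elim: s => [|i s IHs] hz h x; first exact: thinmx0.
have [_ [_ [p1 [p2 [_ _ p1E p2E]]]]] := sum2_homs (F i) (dsum (map F s)).
have h1 : (h x).1 = 0 by rewrite -p1E -(hcompE p1 h) hz ?mem_head.
have h2 : (h x).2 = 0.
  by rewrite -p2E -(hcompE p2 h) IHs // => k ks; apply: hz; rewrite inE ks orbT.
by rewrite [LHS]surjective_pairing h1 h2.
Qed.

Lemma hom_zero_from_dsum (J : eqType) (F : J -> amodule A) (s : seq J) M :
  (forall i, i \in s -> hom_zero (F i) M) -> hom_zero (dsum (map F s)) M.
Proof.
elim: s => [|i s IHs] hz h x; first by rewrite [x]thinmx0 linear0.
have [i1 [i2 [_ [_ [i1E i2E _ _]]]]] := sum2_homs (F i) (dsum (map F s)).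
have -> : x = i1 x.1 + i2 x.2.
  by rewrite i1E i2E; case: x => x y; congr pair; rewrite /= ?addr0 ?add0r.
rewrite linearD /= -(hcompE h i1) -(hcompE h i2) hz ?mem_head // add0r.
by rewrite IHs // => k ks; apply: hz; rewrite inE ks orbT.
Qed.

Lemma dsum_incl (J : eqType) (F : J -> amodule A) (s : seq J) k :
  k \in s -> exists i : modhom (F k) (dsum (map F s)), injective i.
Proof.
elim: s => // l s IHs; rewrite inE.
have [i1 [i2 [_ [_ [i1E i2E _ _]]]]] := sum2_homs (F l) (dsum (map F s)).
case/predU1P=> [->|/IHs[i inji]].
  by exists i1 => x y; rewrite !i1E => -[].
by exists (hcomp i2 i) => x y; rewrite !hcompE !i2E => -[/inji].
Qed.

(** In finite dimension this is the same as an embedding of M into a finite power of T. *)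
Definition cogenerated T M := forall x : M, x <> 0 -> exists f : modhom M T, f x <> 0.

Lemma cogenerated_dsum T r : cogenerated T (dsum (nseq r T)).
Proof.
elim: r => [|r IHr] x x0; first by case: x0; exact: thinmx0.
have [_ [_ [p1 [p2 [_ _ p1E p2E]]]]] := sum2_homs T (dsum (nseq r T)).
have [x1|x1] := pselect (p1 x = 0); last by exists p1.
have [|f fx] := IHr (p2 x); last by exists (hcomp f p2); rewrite hcompE.
move=> x2; apply: x0; rewrite p1E in x1; rewrite p2E in x2.
by rewrite [LHS]surjective_pairing x1 x2.
Qed.

Lemma cogenerated_sub T M N (i : modhom M N) :
  injective i -> cogenerated T N -> cogenerated T M.
Proof.
move=> inji cN x x0; have [|f fx] := cN (i x).
  by move=> ix; apply: x0; apply: inji; rewrite ix linear0.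
by exists (hcomp f i); rewrite hcompE.
Qed.

(** Elements outside M' are detected through M''; for those of M', a map M' -> T that detects them
    extends to M. *)
Lemma cogenerated_ext T M' M M'' (i : modhom M' M) (q : modhom M M'') :
  ses i q -> ext_vanishes M'' T ->
  cogenerated T M' -> cogenerated T M'' -> cogenerated T M.
Proof.
move=> sesM extT c' c'' x x0; have [_ _ ex] := sesM.
have [/ex[y yE]|qx] := pselect (q x = 0).
  have [|f fy] := c' y; first by move=> y0; apply: x0; rewrite yE y0 linear0.
  have [f' f'E] := extT _ _ _ _ sesM f.
  by exists f'; rewrite yE f'E.
by have [f fx] := c'' _ qx; exists (hcomp f q); rewrite hcompE.
Qed.

End Simples.

(** * Projective covers and injective hulls of simple modules *)

Section CoverHull.
Variables (K : fieldType) (A : falgType K).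
Implicit Types M N E I P S T X Y : amodule A.

Lemma cover_ker P S (p : modhom P S) N (f : modhom P N) x :
  projective_cover p -> simple_module S -> f x <> 0 -> forall y, f y = 0 -> p y = 0.
Proof.
move=> [prP sp supp] simS fx y fy; apply: contrapT => py; apply: fx.
suff kf : sspace (hker f) = fullv by apply/eqP; rewrite -mem_hker [sspace _]kf memvf.
apply: supp; apply/vspaceP => z; rewrite memvf.
have /mem_sincl[v vE] : y \in hker f by rewrite mem_hker fy.
have [|u uE] := simple_surj (f := hcomp p (sincl (hker f))) (x := v) simS _ (p z).
  by rewrite hcompE -vE.
rewrite -[z](subrK (sincl (hker f) u)) addrC memv_add //.
  by apply/mem_sincl; exists u.
by rewrite memv_ker linearB /= -uE hcompE subrr.
Qed.

Lemma cover_to_simple P S (p : modhom P S) S' (f : modhom P S') x :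
  projective_cover p -> simple_module S -> simple_module S' -> f x <> 0 ->
  exists2 u : modhom S' S, bijective u & forall y, u (f y) = p y.
Proof.
move=> cov simS simS' fx; have sf := simple_surj simS' fx.
have [_ sp _] := cov.
have [|u uE] := @hom_factor_surj _ _ _ _ _ f p sf; first exact: cover_ker cov simS fx.
exists u => //; have [l l0] := simple_nonzero simS; have [y yE] := sp l.
have uy : u (f y) <> 0 by rewrite uE yE.
exact: bij_hom (simple_inj simS' uy) (simple_surj simS uy).
Qed.

(** By essentiality U meets the image of j, and the part of S that lands in U, being non-zero, is
    all of S. *)
Lemma hull_meets S I (j : modhom S I) (U : submodule I) x :
  injective_hull j -> simple_module S -> x \in U -> x <> 0 -> forall l, j l \in U.
Proof.
move=> [_ injj ess] simS xU x0 l.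
have [z zU [zj z0]] : exists2 z, z \in U & z \in limg j /\ z <> 0.
  apply: contrapT => nz; apply: x0; apply/eqP; rewrite -memv0 -(ess U) //.
  apply/vspaceP => z; rewrite memv0; apply/memv_capP/eqP => [[zU zj]|->].
    by apply: contrapT => z0; apply: nz; exists z.
  by split; exact: mem0v.
have [l' _ zE] := memv_imgP zj.
have := @simple_sub_full _ _ S (hpreim j U) l' simS _ _ l.
rewrite /= -!memv_preim; apply; first by rewrite -zE.
by move=> l0; apply: z0; rewrite zE l0 linear0.
Qed.

(** Every simple submodule of I contains the image of j, hence equals it. *)
Lemma hull_socle S I (j : modhom S I) : injective_hull j -> simple_module S ->
  forall x, x \in socle I <-> exists l, x = j l.
Proof.
move=> hull simS x; rewrite -mem_himg; split.
  apply: subvP; apply: sub_sum_min => U simU.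
  have [u u0] := simple_nonzero simU; apply/subvP => y /mem_sincl[v ->].
  have [l l0] := simple_nonzero simS.
  have /mem_sincl[w wE] : j l \in U.
    apply: (hull_meets (x := sincl U u)) => //; first by apply/mem_sincl; exists u.
    by move=> su; apply: u0; apply: (@sincl_inj _ _ _ U); rewrite su linear0.
  have := simple_sub_full (U := hpreim (sincl U) (himg j)) (x := w) simU _ _ v.
  rewrite /= -!memv_preim -wE; apply; first by apply/mem_himg; exists l.
  move=> w0; apply: l0; have [_ injj _] := hull; apply: injj.
  by rewrite wE w0 !linear0.
apply: subvP; apply: sub_sum_sup; have [f sf fE] := hom_onto_image j.
have [l l0] := simple_nonzero simS; apply: (simple_image (x := l)) simS sf _.
move=> fl; apply: l0; have [_ injj _] := hull; apply: injj.
by rewrite -fE fl !linear0.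
Qed.

(** The image of a non-zero map M -> I contains that of j, so j p lifts to a non-zero map P -> M. *)
Lemma hom_zero_hull P S I (p : modhom P S) (j : modhom S I) M :
  projective_cover p -> injective_hull j -> simple_module S ->
  hom_zero P M -> hom_zero M I.
Proof.
move=> cov hull simS hz h x; apply: contrapT => hx.
have [prP sp _] := cov; have [_ injj _] := hull.
have [f sf fE] := hom_onto_image h.
have [y|u uE] := hom_lift_inj (f := hcomp j p) (@sincl_inj _ _ _ (himg h)).
  rewrite hcompE; apply/mem_sincl; apply: (hull_meets (x := h x)) => //.
  by apply/mem_himg; exists x.
have [l l0] := simple_nonzero simS; have [y yE] := sp l.
apply: l0; apply: injj; rewrite -yE -hcompE -uE linear0.
by rewrite (hom_zero_quo prP sf hz) linear0.
Qed.

End CoverHull.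

(** * Standard and proper costandard modules *)

Section Stratified.
Variables (K : fieldType) (A : falgType K).
Variables (disp : Order.disp_t) (Lam : finPreorderType disp).
Variables (L P I : Lam -> amodule A).
Variables (p : forall lam, modhom (P lam) (L lam)) (j : forall lam, modhom (L lam) (I lam)).
Hypotheses (hL : simple_representatives L) (hsplit : split_over L).
Hypotheses (hP : forall lam, projective_cover (p lam)).
Hypotheses (hI : forall lam, injective_hull (j lam)).
Hypothesis hA : standardly_stratified p.
Implicit Types C M N T X : amodule A.

Local Notation Delta := (standard P).
Local Notation nabla := (proper_costandard I).
Local Notation costd lam := (proper_costandard_sub I lam).
(** The cosyzygy I(lam)/nabla(lam); with it, [lifts M (gam lam)] reads Ext^1(M, nabla(lam)) = 0. *)
Local Notation cosyz lam := (quomod (costd lam)).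
Local Notation kappa lam := (sincl (costd lam)).
Local Notation gam lam := (qproj (costd lam)).

Let simL lam : simple_module (L lam). Proof. by case: hL. Qed.
Let prP lam : projective_module (P lam). Proof. by case: (hP lam). Qed.
Let injI lam : injective_module (I lam). Proof. by case: (hI lam). Qed.
Let injj lam : injective (j lam). Proof. by case: (hI lam). Qed.
Let surjp lam : hsurj (p lam). Proof. by case: (hP lam). Qed.
Let surjd lam : hsurj (standard_proj P lam). Proof. exact: qproj_surj. Qed.
Let sesI lam : ses (kappa lam) (gam lam). Proof. exact: ses_sub. Qed.
Let sesD lam : ses (sincl (hker (standard_proj P lam))) (standard_proj P lam).
Proof. exact: ses_ker. Qed.

Lemma exists_top M (x : M) : x <> 0 -> exists lam (q : modhom M (L lam)), hsurj q.
Proof.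
move=> /exists_simple_quotient[S [q [simS sq]]].
have [_ _ /(_ S simS)[lam [u biju]]] := hL; exists lam, (hcomp u q) => y.
have [z <-] := bij_surj biju y; have [w <-] := sq z.
by exists w; rewrite hcompE.
Qed.

Lemma cover_nonzero lam : exists x, p lam x <> 0.
Proof.
by have [l l0] := simple_nonzero (simL lam); have [x xE] := surjp l; exists x; rewrite xE.
Qed.

Lemma cover_simple_eq sig tau (f : modhom (P sig) (L tau)) x : f x <> 0 -> sig = tau.
Proof.
move=> fx; have [u biju _] := cover_to_simple (hP sig) (simL sig) (simL tau) fx.
by have [_ inj _] := hL; symmetry; apply: inj; exists u.
Qed.

Lemma hom_simple_hull M lam : hom_zero (P lam) M -> hom_zero M (I lam).
Proof. exact: hom_zero_hull (hP lam) (hI lam) (simL lam). Qed.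

Lemma mem_costd lam z : z \in costd lam <->
  forall f : modhom (quomod (socle (I lam)))
               (dsum [seq I mu | mu <- enum Lam & (lam <= mu)%O]),
    f (qproj (socle (I lam)) z) = 0.
Proof.
have -> : (z \in costd lam) = (qproj (socle (I lam)) z \in
    sub_inf (fun U => exists f : modhom (quomod (socle (I lam)))
      (dsum [seq I mu | mu <- enum Lam & (lam <= mu)%O]), U = hker f)).
  by rewrite memv_preim.
rewrite sub_infP; split=> [zU f|zU _ [f ->]].
  by apply/eqP; rewrite -mem_hker; apply: zU; exists f.
by rewrite mem_hker zU.
Qed.

Lemma costd_socle lam l : j lam l \in costd lam.
Proof.
apply/mem_costd => f; suff -> : qproj (socle (I lam)) (j lam l) = 0 by rewrite linear0.
by apply/qproj_eq0/(hull_socle (hI lam) (simL lam)); exists l.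
Qed.

Lemma exists_simple_costd lam : exists k : modhom (L lam) (nabla lam),
  forall l, kappa lam (k l) = j lam l.
Proof.
apply: hom_lift_inj => [|l]; first exact: sincl_inj.
by apply/mem_sincl; exact: costd_socle.
Qed.

(** By definition of nabla(lam), elements of I(lam)/nabla(lam) are detected by maps into the I(mu)
    with mu >= lam, and M has no non-zero map to these. *)
Lemma hom_zero_cosyz M lam :
  (forall mu, (lam <= mu)%O -> hom_zero (P mu) M) -> hom_zero M (cosyz lam).
Proof.
move=> hz h x; have [z zE] := qproj_surj (h x).
rewrite -zE; apply/qproj_eq0/mem_costd => f.
have [y /qproj_eq0 /mem_costd fy|f' f'E] :=
  @hom_factor_surj _ _ _ _ _ (gam lam) (hcomp f (qproj (socle (I lam)))) (@qproj_surj _ _ _ _).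
  by rewrite hcompE.
rewrite -hcompE -f'E zE -hcompE; apply: hom_zero_dsum => mu.
rewrite mem_filter => /andP[lemu _]; apply: hom_simple_hull; exact: hz.
Qed.

(* The proper costandard module has no composition factor L sig above its
   socle, for sig above lam. *)
Lemma cover_to_costd sig lam (f : modhom (P sig) (I lam)) :
  (lam <= sig)%O -> (forall x, f x \in costd lam) -> forall x, exists l, f x = j lam l.
Proof.
move=> le fU x; apply/(hull_socle (hI lam) (simL lam))/qproj_eq0; apply: contrapT => ux.
pose u := hcomp (qproj (socle (I lam))) f.
have uE y : u y = qproj (socle (I lam)) (f y) by exact: hcompE.
have [v sv vE] := hom_onto_image u.
have [y vy|t tE] := @hom_factor_surj _ _ _ _ _ v (p sig) sv.
  apply: (cover_ker (f := u) (x := x) (hP sig) (simL sig)); first by rewrite uE.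
  by rewrite -vE vy linear0.
(* The image of u has L(sig) as a quotient; injectivity of I(sig) extends this to a map w on
   I(lam)/soc, one of those that must kill nabla(lam). *)
have [w wE] := injI (hcomp (j sig) t) (@sincl_inj _ _ _ (himg u)).
have [|e inje] := @dsum_incl _ _ _ I [seq mu <- enum Lam | (lam <= mu)%O] sig.
  by rewrite mem_filter le mem_enum.
have [y py] := cover_nonzero sig; apply: py; apply: (@injj sig); apply: inje.
rewrite linear0 -tE -(hcompE (j sig) t) -wE vE uE linear0 -(hcompE e w).
by have /mem_costd := fU y; apply.
Qed.

(** * Maps and extensions from standard to proper costandard modules *)

Lemma standard_support sig mu : ~ hom_zero (P sig) (Delta mu) -> (sig <= mu)%O.
Proof.
move=> nz; apply: contrapT => nle; apply: nz; case: (hA mu) => _ [g gE filt].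
have sg : hsurj g by move=> l; have [x <-] := surjp l; exists (standard_proj P mu x); rewrite gE.
(* The only simple module that P(sig) maps onto is L(sig), and by condition (2) the factors of
   Delta(mu) are L(tau) with tau <= mu. *)
have top tau : (tau <= mu)%O -> hom_zero (P sig) (L tau).
  move=> le f x; apply: contrapT => /cover_simple_eq eq_st.
  by apply: nle; rewrite eq_st.
apply: hom_zero_ext (ses_ker sg) _ (top _ (lexx _)).
elim/filtered_ind: filt => [N N0 f x|N tau q le sq IH]; first exact: N0.
exact: hom_zero_ext (ses_ker sq) IH (top _ le).
Qed.

(** A non-zero h makes L(lam) a composition factor of Delta(mu), so lam <= mu; then P(mu) can reach
    only the socle of nabla(lam). *)
Lemma standard_to_costd mu lam (h : modhom (Delta mu) (nabla lam)) x :
  h x <> 0 ->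
  exists2 f : modhom (P mu) (L lam),
    exists y, f y <> 0 & forall y, kappa lam (h (standard_proj P mu y)) = j lam (f y).
Proof.
move=> hx; have kx : kappa lam (h x) <> 0.
  by move=> k0; apply: hx; apply: (@sincl_inj _ _ _ (costd lam)); rewrite k0 linear0.
have le : (lam <= mu)%O.
  apply: standard_support => /hom_simple_hull/(_ (hcomp (kappa lam) h) x).
  by rewrite hcompE.
pose f := hcomp (kappa lam) (hcomp h (standard_proj P mu)).
have [y|f' f'E] := hom_lift_inj (f := f) (@injj lam).
  apply: cover_to_costd le _ y => z; rewrite hcompE; apply/mem_sincl.
  by exists (hcomp h (standard_proj P mu) z).
exists f'; last by move=> y; rewrite f'E !hcompE.
have [y yE] := surjd x; exists y => f'y; apply: kx.
by rewrite -yE -(hcompE h) -(hcompE (kappa lam)) -f'E f'y linear0.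
Qed.

Lemma standard_to_costd_eq mu lam : ~ hom_zero (Delta mu) (nabla lam) -> mu = lam.
Proof.
by move=> /not_hom_zero[h [x /standard_to_costd[f [y fy] _]]]; exact: cover_simple_eq fy.
Qed.

(** The induced map P(lam) -> L(lam), if non-zero, differs from p by an endomorphism of L(lam),
    which is a scalar since A is split. *)
Lemma standard_to_costd_scalar lam (h : modhom (Delta lam) (nabla lam)) :
  exists c : K, forall y, kappa lam (h (standard_proj P lam y)) = c *: j lam (p lam y).
Proof.
have [h0|/existsNP[x hx]] := pselect (forall x, h x = 0).
  by exists 0 => y; rewrite h0 linear0 scale0r.
have [f [y fy] fE] := standard_to_costd hx.
have [u _ uE] := cover_to_simple (hP lam) (simL lam) (simL lam) fy.
have [c cE] := hsplit u.
have c0 : c != 0.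
  apply/eqP => c0; have [z pz] := cover_nonzero lam.
  by apply: pz; rewrite -uE cE c0 scale0r.
exists c^-1 => z; rewrite fE -uE cE linearZ /= scalerA mulVf //.
by rewrite scale1r.
Qed.

(** If mu < lam, extend to I(lam): the induced map Delta(mu) -> I(lam)/nabla(lam) is zero, as no
    factor of Delta(mu) has index >= lam. Otherwise the kernel is filtered by Delta(tau) with tau >
    mu, so tau differs from lam and there is no non-zero map to nabla(lam). *)
Lemma extends_standard_costd mu lam :
  extends (sincl (hker (standard_proj P mu))) (nabla lam).
Proof.
move=> h; have [lt_ml|nlt_ml] := boolP (mu < lam)%O.
  have [f fE] := injI (hcomp (kappa lam) h) (@sincl_inj _ _ _ (hker (standard_proj P mu))).
  have [y|t tE] := @hom_factor_surj _ _ _ _ _ _ (hcomp (gam lam) f) (@surjd mu).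
    have [_ _ ex] := sesD mu; move/ex => [z ->].
    by rewrite hcompE fE hcompE (ses_comp0 _ (sesI lam)).
  have t0 : hom_zero (Delta mu) (cosyz lam).
    apply: hom_zero_cosyz => sig le_ls; apply: contrapT => /standard_support le_sm.
    by move: lt_ml; rewrite lt_le_def (le_trans le_ls le_sm) andbF.
  have [x|f' f'E] := hom_lift_inj (f := f) (@sincl_inj _ _ _ (costd lam)).
    by apply/mem_sincl/qproj_eq0; rewrite -hcompE -tE t0.
  by exists f' => x; apply: (@sincl_inj _ _ _ (costd lam)); rewrite f'E fE hcompE.
suff hz : hom_zero (submod (hker (standard_proj P mu))) (nabla lam).
  by exists (hzero _ _) => x; rewrite hzeroE hz.
case: (hA mu) => + _.
elim/filtered_ind => [N N0 f x|N tau q lt_mt sq IH]; first by rewrite (N0 x) linear0.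
apply: hom_zero_from_ext (ses_ker sq) IH _; apply: contrapT => /standard_to_costd_eq eq_tl.
by move: nlt_ml; rewrite -eq_tl lt_mt.
Qed.

Lemma lifts_standard mu lam : lifts (Delta mu) (gam lam).
Proof.
apply: lifts_quo (sesI lam) (sesD mu) _ (@extends_standard_costd mu lam).
exact: lifts_proj (@prP mu) (@qproj_surj _ _ _ _).
Qed.

Lemma lifts_filtered R M lam : filtered Delta R M -> lifts M (gam lam).
Proof.
elim/filtered_ind => {M} [N N0 h|N tau q _ sq IH].
  by exists (hzero _ _) => x; rewrite (N0 x) !linear0.
exact: lifts_ext (@injI lam) (ses_ker sq) IH (@lifts_standard tau lam).
Qed.

Lemma standard_ext_filtered R T mu : filtered nabla R T -> ext_vanishes (Delta mu) T.
Proof.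
move=> filt; apply: ext_vanishes_proj (@prP mu) (sesD mu) _.
elim/filtered_ind: filt => [N N0 h|N tau q _ sq IH].
  by exists (hzero _ _) => x; rewrite hzeroE (N0 (h x)).
exact: extends_ext (@prP mu) (ses_ker sq) IH (@extends_standard_costd mu tau).
Qed.

(* By dimension shifting, Ext^1(-, cosyz lam) is Ext^2(-, nabla lam). *)
Lemma standard_ext_cosyz mu lam : ext_vanishes (Delta mu) (cosyz lam).
Proof.
apply: ext_vanishes_proj (@prP mu) (sesD mu) _.
apply: extends_lift (@injI lam) (@sincl_inj _ _ _ _) _.
(* By condition (1) the kernel of P(mu) -> Delta(mu) is itself filtered by standard modules. *)
by case: (hA mu) => + _; exact: lifts_filtered.
Qed.

(** * Pairing a module with a standard and a proper costandard module *)

Lemma exists_maximal (Z : Lam -> Prop) sig :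
  Z sig -> exists2 lam, Z lam & forall mu, (lam < mu)%O -> ~ Z mu.
Proof.
move: {2}#|[set mu | (sig < mu)%O]|.+1 (ltnSn #|[set mu | (sig < mu)%O]|) => n.
elim: n sig => // n IHn sig ltn Zsig.
have [max|/existsNP[mu /not_implyP[lt_sm /contrapT Zmu]]] :=
  pselect (forall mu, (sig < mu)%O -> ~ Z mu); first by exists sig.
apply: IHn Zmu; rewrite -ltnS (leq_trans _ ltn) // ltnS; apply: proper_card.
apply/properP; split.
  by apply/subsetP => nu; rewrite !inE => /(lt_trans lt_sm).
by exists mu; rewrite !inE ?ltxx.
Qed.

Lemma cover_factor_standard lam C (f : modhom (P lam) C) :
  (forall mu, (lam < mu)%O -> hom_zero (P mu) C) ->
  exists f' : modhom (Delta lam) C, forall x, f' (standard_proj P lam x) = f x.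
Proof.
move=> hz; apply: hom_factor_surj => [|x]; first exact: surjd.
move/qproj_eq0 => xU; apply/eqP; rewrite -mem_hker.
suff /subvP sub : (mod_trace (Pabove P lam) (P lam) <= hker f)%VS by exact: sub.
apply: sub_sum_min => _ [k ->]; apply/subvP => _ /mem_himg[y ->].
rewrite mem_hker -hcompE; apply/eqP; apply: hom_zero_from_dsum => mu.
by rewrite mem_filter => /andP[lt _]; exact: hz.
Qed.

(** Take lam maximal with Hom(P(lam), C) non-zero and a simple quotient L(tau) of the submodule C'
    below. A map P(tau) -> C' that hits this quotient induces f, and C' -> L(tau) -> nabla(tau)
    extends to phi on C. *)
Lemma exists_pairing C (x : C) : x <> 0 ->
  exists tau (f : modhom (Delta tau) C) (phi : modhom C (nabla tau)) y, phi (f y) <> 0.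
Proof.
move=> x0; have [sig0 [q sq]] := exists_top x0.
have [f0 f0E] := prP (p sig0) sq.
have Z0 : ~ hom_zero (P sig0) C.
  move=> hz; have [y py] := cover_nonzero sig0.
  by apply: py; rewrite -f0E hz linear0.
have [lam Zlam max] := exists_maximal (Z := fun mu => ~ hom_zero (P mu) C) Z0.
have {}max mu : (lam < mu)%O -> hom_zero (P mu) C by move=> /max/contrapT.
(* C' absorbs every composition factor L(sig) with sig >= lam; none remains in C/C'. *)
pose C' := sub_sum (fun U : submodule C =>
  exists2 sig, (lam <= sig)%O & exists f : modhom (P sig) C, U = himg f).
have memC' sig (f : modhom (P sig) C) z : (lam <= sig)%O -> f z \in C'.
  move=> le.
  have /subvP : (himg f <= C')%VS by apply: sub_sum_sup; exists sig => //; exists f.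
  by apply; apply/mem_himg; exists z.
have [f1 [z1 fz1]] := not_hom_zero Zlam.
have [z1' z1E] : exists z1', f1 z1 = sincl C' z1' by apply/mem_sincl/memC'.
have z1'0 : z1' <> 0 by move=> z0; apply: fz1; rewrite z1E z0 linear0.
have [tau [s ss]] := exists_top z1'0.
have [sig le_ls [f [z [z' zE sz']]]] : exists2 sig, (lam <= sig)%O &
    exists (f : modhom (P sig) C) z, exists2 z', f z = sincl C' z' & s z' <> 0.
  apply: contrapT => nex.
  (* Otherwise all generators of C' lie in the kernel of s, although s is onto L(tau). *)
  have C'0 : (C' <= himg (hcomp (sincl C') (sincl (hker s))))%VS.
    apply: sub_sum_min => _ [sig le [f ->]]; apply/subvP => _ /mem_himg[z ->].
    have /mem_sincl[z' zE] := memC' sig f z le.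
    have /mem_sincl[w wE] : z' \in hker s.
      rewrite mem_hker; apply/eqP; apply: contrapT => sz; apply: nex.
      by exists sig => //; exists f, z, z'.
    by apply/mem_himg; exists w; rewrite hcompE -wE.
  have [l l0] := simple_nonzero (simL tau); have [w wE] := ss l; apply: l0.
  rewrite -wE; have /mem_himg[v] : sincl C' w \in himg (hcomp (sincl C') (sincl (hker s))).
    by move/subvP: C'0; apply; apply/mem_sincl; exists w.
  rewrite hcompE => /sincl_inj ->; exact: ses_comp0 (ses_ker ss).
have [y|fC fCE] := hom_lift_inj (f := f) (@sincl_inj _ _ _ C').
  exact/mem_sincl/memC'.
have fCz : fC z = z' by apply: (@sincl_inj _ _ _ C'); rewrite fCE.
have st : sig = tau by apply: (cover_simple_eq (f := hcomp s fC) (x := z)); rewrite hcompE fCz.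
case: tau / st s ss sz' => s ss sz'.
have [f' f'E] : exists f' : modhom (Delta sig) C, forall x, f' (standard_proj P sig x) = f x.
  by apply: cover_factor_standard => mu lt; apply: max; exact: le_lt_trans le_ls lt.
have [k kE] := exists_simple_costd sig.
(* With no factor of index >= sig, C/C' has no non-zero map to I(sig)/nabla(sig), whence Ext^1(C/C',
   nabla(sig)) = 0. *)
have hzQ : hom_zero (quomod C') (cosyz sig).
  apply: hom_zero_cosyz => rho le_sr g w.
  have [g' g'E] := prP g (@qproj_surj _ _ _ C').
  rewrite -g'E; apply/qproj_eq0/memC'; exact: le_trans le_ls le_sr.
have ext : ext_vanishes (quomod C') (nabla sig).
  apply: lifts_ext_vanishes (@injI sig) (sesI sig) _ => h.
  by exists (hzero _ _) => w; rewrite hzeroE linear0 hzQ.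
have [phi phiE] := ext _ _ _ _ (ses_sub C') (hcomp k s).
exists sig, f', phi, (standard_proj P sig z); rewrite f'E zE phiE hcompE => k0.
by apply: sz'; apply: (@injj sig); rewrite -kE k0 !linear0.
Qed.

(** * Modules orthogonal to the proper costandard modules *)

Section Tilting.
Variable T : amodule A.
Hypothesis hT : tilting P I T.
Variable r : nat.
Hypothesis hincl :
  forall lam, exists f : modhom (standard P lam) (dsum (nseq r T)), injective f.

(** The second clause makes cogeneration pass to extensions. The third is Ext^2(C, nabla(lam)) = 0,
    through which [lifts] passes to a submodule with quotient C. *)
Definition good C :=
  [/\ cogenerated T C, ext_vanishes C T & forall lam, ext_vanishes C (cosyz lam)].

Lemma good_ext M' M M'' (i : modhom M' M) (q : modhom M M'') :
  ses i q -> good M' -> good M'' -> good M.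
Proof.
move=> sesM [c' t' e'] [c'' t'' e'']; split.
- exact: cogenerated_ext sesM t'' c' c''.
- exact: ext_vanishes_ext sesM t' t''.
- by move=> lam; exact: ext_vanishes_ext sesM (e' lam) (e'' lam).
Qed.

Lemma good_zero M : (forall x : M, x = 0) -> good M.
Proof.
move=> M0; have ext N : ext_vanishes M N.
  move=> E' E i q [inji _ ex] h; apply: hom_factor_surj => [y|x /eqP].
    by have /ex[x ->] := M0 (q y); exists x.
  rewrite -(linear0 i) => /eqP/inji ->; exact: linear0.
by split=> // x; rewrite (M0 x).
Qed.

Lemma good_standard mu : good (Delta mu).
Proof.
split=> [||lam].
- by have [f injf] := hincl mu; apply: cogenerated_sub injf _; exact: cogenerated_dsum.
- by case: hT => _; exact: standard_ext_filtered.
- exact: standard_ext_cosyz.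
Qed.

(** Induction on the dimension: the image C1 of a standard module paired with nabla(tau) has a good
    quotient C/C1, and this forces C1 to be Delta(tau) itself. *)
Lemma good_lifts C : (forall lam, lifts C (gam lam)) -> good C.
Proof.
move: {2}(dim C).+1 (ltnSn (dim C)) => n; elim: n C => // n IHn C ltn liftC.
have [C0|/existsNP[x /exists_pairing[tau [f [phi [y phify]]]]]] :=
  pselect (forall x : C, x = 0); first exact: good_zero.
have fy : f y <> 0 by move=> fy; apply: phify; rewrite fy linear0.
pose C1 := himg f; have [f1 sf1 f1E] := hom_onto_image f.
have scalar (h h' : modhom (Delta tau) (nabla tau)) :
    h y <> 0 -> exists c : K, forall x, h' x = c *: h x.
  move=> hy; have [a aE] := standard_to_costd_scalar h.
  have [b bE] := standard_to_costd_scalar h'.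
  have a0 : a != 0.
    apply/eqP => a0; apply: hy; have [w <-] := surjd y.
    by apply: (@sincl_inj _ _ _ (costd tau)); rewrite aE a0 scale0r linear0.
  (* Composed with P(tau) -> Delta(tau) and nabla(tau) -> I(tau), h and h' are a and b times j p. *)
  exists (b / a) => w; have [v <-] := surjd w; apply: (@sincl_inj _ _ _ (costd tau)).
  by rewrite homZ bE aE scalerA divfK.
(* A map C1 -> nabla(lam) is zero, or lam = tau and it is a multiple of the restriction of phi. *)
have ext1 lam : extends (sincl C1) (nabla lam).
  move=> h; have [hz|/standard_to_costd_eq eq_tl] := pselect (hom_zero (Delta tau) (nabla lam)).
    exists (hzero _ _) => z; have [w <-] := sf1 z.
    by rewrite hzeroE -(hcompE h) hz.
  case: lam / eq_tl h => h.
  have [|c cE] := scalar (hcomp phi f) (hcomp h f1); first by rewrite hcompE.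
  exists (haxpy c phi (hzero _ _)) => z; have [w <-] := sf1 z.
  by rewrite haxpyE hzeroE addr0 f1E -(hcompE phi) -cE hcompE.
have liftQ lam : lifts (quomod C1) (gam lam).
  exact: lifts_quo (sesI lam) (ses_sub C1) (liftC lam) (ext1 lam).
have goodQ : good (quomod C1).
  apply: IHn liftQ; rewrite -ltnS (leq_trans _ ltn) // ltnS.
  by apply: dim_quomod_lt fy; apply/mem_himg; exists y.
have lift1 lam : lifts (submod C1) (gam lam).
  apply: lifts_sub (liftC lam); have [_ _ /(_ lam) ext] := goodQ.
  exact: ext (ses_sub C1).
have injf : injective f.
  have [inj0 _ ex] := ses_ker sf1.
  apply/hom_injP => z fz; apply: contrapT => z0.
  have [z' zE] : exists z', z = sincl (hker f1) z'.
    by apply/ex; apply: (@sincl_inj _ _ _ C1); rewrite f1E linear0.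
  have z'0 : z' <> 0 by move=> z'0; apply: z0; rewrite zE z'0 linear0.
  have [nu [q sq]] := exists_top z'0.
  have [k kE] := exists_simple_costd nu.
  (* Since Ext^1(C1, nabla(nu)) = 0, a non-zero map from ker f to nabla(nu) extends to Delta(tau).
     But maps Delta(tau) -> nabla(nu) are zero or multiples of phi f, and so kill ker f. *)
  have [h hE] := lifts_ext_vanishes (@injI nu) (sesI nu) (lift1 nu) (ses_ker sf1) (hcomp k q).
  have [l l0] := simple_nonzero (simL nu); have [w wE] := sq l.
  apply: l0; apply: (@injj nu); rewrite -kE -wE -hcompE -hE !linear0.
  suff -> : h (sincl (hker f1) w) = 0 by rewrite linear0.
  have fw : f (sincl (hker f1) w) = 0 by rewrite -f1E (ses_comp0 _ (ses_ker sf1)) linear0.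
  have [hz|/standard_to_costd_eq eq_tn] := pselect (hom_zero (Delta tau) (nabla nu)).
    exact: hz.
  clear -eq_tn h fw scalar phify y phi f; case: nu / eq_tn h => h.
  have [|c ->] := scalar (hcomp phi f) h; first by rewrite hcompE.
  by rewrite hcompE fw linear0 scaler0.
exact: good_ext (ses_im injf) (good_standard tau) goodQ.
Qed.

End Tilting.

End Stratified.

(** * The double centraliser property *)

Section DoubleCentraliser.
Variables (K : fieldType) (A : falgType K).
Implicit Types M N X T : amodule A.

(** * The regular module *)

Section Regular.

Lemma reg_actDr k (a x y : A) : a * (k *: x + y) = k *: (a * x) + a * y.
Proof. by rewrite mulrDr -scalerAr. Qed.

Lemma reg_actDl k (a b x : A) : (k *: a + b) * x = k *: (a * x) + b * x.
Proof. by rewrite mulrDl -scalerAl. Qed.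

Lemma reg_actM (a b x : A) : a * b * x = a * (b * x).
Proof. by rewrite mulrA. Qed.

Definition regmod : amodule A := AModule reg_actDr reg_actDl (@mul1r A) reg_actM.

Lemma hom_regmod_exists M (x : M) : exists h : modhom regmod M, forall a, h a = act a x.
Proof. by apply: (@hom_exists _ _ regmod M (fun a => act a x)) => *; rewrite ?actDl ?actM. Qed.

Lemma hom_regmodE M (h : modhom regmod M) (a : A) : h a = act a (h (1 : A)).
Proof. by rewrite -hact /= mulr1. Qed.

Lemma regmod_projective : projective_module regmod.
Proof.
move=> N N' g f sg; have [n nE] := sg (f (1 : A)).
have [h hE] := hom_regmod_exists n; exists h => a.
by rewrite hE hact nE -hom_regmodE.
Qed.

End Regular.

Lemma act_lfun_exists M a : exists h : 'End(M), forall x, h x = act a x.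
Proof.
pose hl : {linear M -> M} := HB.pack (act a : M -> M)
  (GRing.isLinear.Build K M M *:%R (act a) (fun k => actDr k a)).
by exists (linfun hl) => x; rewrite lfunE.
Qed.

(** * The module of linear endomorphisms *)

Section EndModule.
Variable M : amodule A.

Definition act_lfun a : 'End(M) := sval (cid (act_lfun_exists M a)).

Lemma act_lfunE a x : act_lfun a x = act a x.
Proof. by rewrite /act_lfun; case: cid. Qed.

Definition end_act a (f : 'End(M)) : 'End(M) := (act_lfun a \o f)%VF.

Lemma end_actE a f x : end_act a f x = act a (f x).
Proof. by rewrite comp_lfunE act_lfunE. Qed.

Lemma end_actDr k a f g : end_act a (k *: f + g) = k *: end_act a f + end_act a g.
Proof. by apply/lfunP => x; rewrite !(end_actE, add_lfunE, scale_lfunE) actDr. Qed.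

Lemma end_actDl k a b f : end_act (k *: a + b) f = k *: end_act a f + end_act b f.
Proof. by apply/lfunP => x; rewrite !(end_actE, add_lfunE, scale_lfunE) actDl. Qed.

Lemma end_act1 f : end_act 1 f = f.
Proof. by apply/lfunP => x; rewrite end_actE act1. Qed.

Lemma end_actM a b f : end_act (a * b) f = end_act a (end_act b f).
Proof. by apply/lfunP => x; rewrite !end_actE actM. Qed.

(* Hom_K(M, M), on which A acts through the target: a direct sum of dim M copies
   of M, in which the identity is the tuple of all vectors of a basis. *)
Definition endmod : amodule A := AModule end_actDr end_actDl end_act1 end_actM.

Lemma endmod_eval x : exists h : modhom endmod M, forall f : 'End(M), h f = f x.
Proof.
apply: (@hom_exists _ _ endmod M (fun f : 'End(M) => f x)) => [k f g|a f].
  by rewrite add_lfunE scale_lfunE.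
by rewrite /= end_actE.
Qed.

(** For xi a coordinate form, these rank-one maps embed M as one of the direct summands. *)
Lemma endmod_coord (xi : 'Hom(M, K^o)) :
  exists h : modhom M endmod, forall x y, (h x : 'End(M)) y = xi y *: x.
Proof.
have ex x : exists f : 'End(M), forall y, f y = xi y *: x.
  have lin : linear (fun y => xi y *: x).
    by move=> k y z; rewrite linearP scalerDl scalerA.
  pose hl : {linear M -> M} := HB.pack (fun y : M => xi y *: x)
    (GRing.isLinear.Build K M M *:%R _ lin).
  by exists (linfun hl) => y; rewrite lfunE.
have [k x y|a x|h hE] := @hom_exists _ _ M endmod (fun x => sval (cid (ex x))).
- apply/lfunP => z; rewrite add_lfunE scale_lfunE.
  do 3![case: cid => ? /= ->]; by rewrite scalerDr !scalerA mulrC.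
- apply/lfunP => z; rewrite /= end_actE.
  do 2![case: cid => ? /= ->]; by rewrite actZ.
by exists h => x y; rewrite hE; case: cid => f /= ->.
Qed.

Let b := vbasis {:M}.

Lemma coord_lfun_exists i : exists xi : 'Hom(M, K^o), forall x, xi x = coord b i x.
Proof. by exists (linfun (coord b i : M -> K^o)) => x; rewrite lfunE. Qed.

(** Expanding the argument in the basis writes f as the sum of the rank-one maps given by the i-th
    coordinate and the vector f b_i. *)
Lemma endmod_decomp : exists h : 'I_(\dim {:M}) -> modhom M endmod,
  forall f : 'End(M), f = \sum_i h i (f b`_i).
Proof.
have ex i : exists h : modhom M endmod, forall x y, (h x : 'End(M)) y = coord b i y *: x.
  have [xi xiE] := coord_lfun_exists i; have [h hE] := endmod_coord xi.
  by exists h => x y; rewrite hE xiE.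
exists (fun i => sval (cid (ex i))) => f; apply/lfunP => x.
rewrite sum_lfunE {1}(coord_vbasis (memvf x)) linear_sum; apply: eq_bigr => i _.
by rewrite linearZ; case: cid => h /= ->.
Qed.

Lemma lifts_endmod I Q (g : modhom I Q) : lifts M g -> lifts endmod g.
Proof.
move=> liftM h; have [d dE] := endmod_decomp.
have ex i : exists h' : modhom M I, forall x, g (h' x) = h (d i x).
  by have [h' h'E] := liftM (hcomp h (d i)); exists h' => x; rewrite h'E hcompE.
pose h' i := sval (cid (ex i)).
have h'E i x : g (h' i x) = h (d i x) by rewrite /h'; case: cid.
have [k f f'|a f|t tE] := @hom_exists _ _ endmod I (fun f : 'End(M) => \sum_i h' i (f b`_i)).
- rewrite scaler_sumr -big_split; apply: eq_bigr => i _ /=.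
  by rewrite add_lfunE scale_lfunE linearP.
- rewrite act_sum; apply: eq_bigr => i _.
  by rewrite /= end_actE hact.
exists t => f; rewrite tE linear_sum [in RHS](dE f) linear_sum.
by apply: eq_bigr => i _; exact: h'E.
Qed.

(* A map endmod -> M is a sum of endomorphisms of M evaluated at the basis. *)
Lemma endmod_commute (g : 'End(M)) (h : modhom endmod M) :
  (forall (f : modhom M M) x, g (f x) = f (g x)) ->
  h g = g (h (\1%VF : 'End(M))).
Proof.
move=> gC; have [d dE] := endmod_decomp.
rewrite [in LHS](dE g) [in RHS](dE \1%VF) !linear_sum; apply: eq_bigr => i _ /=.
by rewrite id_lfunE -!(hcompE h (d i)) gC.
Qed.

(** In each component, evaluation at a vector sends the identity to that vector. *)
Lemma endmod_eval_dsum r (z : dsum (nseq r M)) :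
  exists h : modhom endmod (dsum (nseq r M)), h (\1%VF : 'End(M)) = z.
Proof.
elim: r z => [|r IHr] z; first by exists (hzero _ _); rewrite hzeroE [RHS]thinmx0.
have [i1 [i2 [_ [_ [i1E i2E _ _]]]]] := sum2_homs M (dsum (nseq r M)).
have [h1 h1E] := endmod_eval z.1; have [h2 h2E] := IHr z.2.
exists (haxpy 1 (hcomp i1 h1) (hcomp i2 h2)).
rewrite haxpyE scale1r !hcompE h1E h2E id_lfunE i1E i2E.
by case: z {h1E h2E} => x y; congr pair; rewrite /= ?addr0 ?add0r.
Qed.

(** The left add(M)-approximation of A: it sends 1 to the identity, so every map A -> M factors
    through it by an evaluation. *)
Lemma regmod_endmod : exists h : modhom regmod endmod,
  forall (a : A) x, (h a : 'End(M)) x = act a x.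
Proof.
have [h hE] := hom_regmod_exists (\1%VF : endmod); exists h => a x.
by rewrite hE /= end_actE id_lfunE.
Qed.

End EndModule.

End DoubleCentraliser.

Theorem theorem1p9 (K : fieldType) (A : falgType K)
  (disp : Order.disp_t) (Lam : finPreorderType disp)
  (L P I : Lam -> amodule A)
  (p : forall lam, modhom (P lam) (L lam)) (j : forall lam, modhom (L lam) (I lam))
  (hL : simple_representatives L) (hsplit : split_over L)
  (hP : forall lam, projective_cover (p lam))
  (hI : forall lam, injective_hull (j lam))
  (hA : standardly_stratified p)
  (T : amodule A) (hT : tilting P I T)
  (r : nat)
  (hincl : forall lam, exists f : modhom (standard P lam) (dsum (nseq r T)), injective f)
  (hproj : forall lam, exists f : modhom (dsum (nseq r T)) (proper_costandard I lam), hsurj f) :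
  faithful_module T /\ double_centraliser T.
Proof.
have goodP := good_lifts hL hsplit hP hI hA hT hincl.
split=> [a aT|g gC].
  (* A is projective, hence cogenerated by T, while every map A -> T sends a to a multiple a x,
     which is zero. *)
  apply: contrapT => a0; have [|cog _ _] := goodP (regmod A).
    by move=> lam; apply: lifts_proj; [exact: regmod_projective|exact: qproj_surj].
  by have [f fa] := cog a a0; apply: fa; rewrite hom_regmodE aT.
have [rho rhoE] := regmod_endmod T; have [e se eE] := hom_onto_image rho.
have rho1 : rho (1 : A) = (\1%VF : 'End(T)).
  by apply/lfunP => x; rewrite rhoE act1 id_lfunE.
have liftT lam : lifts T (qproj (proper_costandard_sub I lam)).
  by case: hT => filt _; apply: lifts_filtered filt; eassumption.
have [|cog _ _] := goodP (quomod (himg rho)).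
  move=> lam; apply: lifts_quo (ses_sub _) (ses_sub _) (lifts_endmod (liftT lam)) _ => h.
  (* A map h on the image of A is determined by its value at the image of 1. That value is pi z with
     z in T^r, and a map psi sending the identity to z makes pi psi extend h. *)
  have [pi spi] := hproj lam; have [z zE] := spi (h (e (1 : A))).
  have [psi psiE] := endmod_eval_dsum z.
  exists (hcomp pi psi) => u; have [a <-] := se u.
  by rewrite eE !(hom_regmodE _ a) rho1 hcompE !hact psiE zE.
suff /mem_himg[a aE] : (g : endmod T) \in himg rho.
  by exists a => x; rewrite -rhoE -aE.
(* A map f on the cokernel that is non-zero at the class of g would, by commutation, have there the
   value of g at f(class of the identity); but the identity is the image of 1, so its class is
   zero. *)
apply/qproj_eq0; apply: contrapT => /cog[f]; apply.
rewrite -hcompE endmod_commute // hcompE.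
suff /qproj_eq0 -> : (\1%VF : endmod T) \in himg rho by rewrite !linear0.
by apply/mem_himg; exists (1 : A).
Qed.
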